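(* Let $G$ be a finite group with identity $e$. If $H$ is a subgroup of $G$ that is a vertex of $\Gamma(G)$ and $\{e\}\subsetneq H\subseteq \Phi(G)$, then $H$ is an isolated vertex of $\Gamma(G)$. Conversely, if $G$ is nilpotent and $H$ is an isolated vertex of $\Gamma(G)$, then $H\subseteq \Phi(G)$.
   Context: For a group $G$, the co-maximal subgroup graph $\Gamma(G)$ is the simple undirected graph whose vertices are the non-trivial proper subgroups of $G$, two distinct vertices $H,K$ being adjacent if and only if $HK=G$, where $HK=\{hk : h\in H, k\in K\}$. $\Phi(G)$ denotes the Frattini subgroup, i.e. the intersection of all maximal subgroups of $G$. A vertex is isolated if it is adjacent to no other vertex. *)

(* Defs.v *)
From mathcomp Require Import all_boot all_fingroup all_solvable.

Set Implicit Arguments.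
Unset Strict Implicit.
Unset Printing Implicit Defensive.

Local Open Scope group_scope.

(* The co-maximal subgroup graph Gamma(G), given by its vertex predicate and
   its adjacency relation on the subgroups of the ambient finGroupType. *)
Definition comax_vertex (gT : finGroupType) (G : {group gT})
    : pred {group gT} :=
  fun H => (H :!=: 1) && (H \proper G).

(* H * K is the pointwise product {hk | h in H, k in K}, not the join. *)
Definition comax_adj (gT : finGroupType) (G : {group gT})
    : rel {group gT} :=
  fun H K => [&& comax_vertex G H, comax_vertex G K, H != K & H * K == G].

Definition comax_isolated (gT : finGroupType) (G H : {group gT}) : Prop :=
  comax_vertex G H /\ (forall K : {group gT}, ~~ comax_adj G H K).

(* Main.v *)
Require Import Defs.
From mathcomp Require Import all_boot all_fingroup all_solvable.

Set Implicit Arguments.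
Unset Strict Implicit.

(** Elements of the Frattini subgroup are non-generators of [G]: if [H] lies
    in ['Phi(G)] and [H * K = G], then [K] together with ['Phi(G)] generates
    [G], whence [K] alone does ([Phi_nongen]); so [K] is not proper and [H] has
    no neighbour.

    For the converse, let [H] be a vertex outside ['Phi(G)].  Then some maximal
    subgroup [M] does not contain [H].  In a nilpotent group proper subgroups
    are properly contained in their normalisers, so [M] is normal
    ([nilpotent_maximal_normal]); the pointwise product [H * M] is therefore a
    subgroup, and since it strictly contains [M] it is the whole of [G]
    ([mulg_normal_maximal]).  Thus
    [M] is a neighbour of [H].  That [M] is nontrivial, hence a vertex, comes
    from [1 < H < G]: the trivial subgroup is not maximal. *)

Local Open Scope group_scope.

(** By maximality the normaliser of [M] in [G] is [M] or [G], and the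
    normaliser condition for nilpotent groups excludes [M]. *)
Lemma nilpotent_maximal_normal (gT : finGroupType) (G M : {group gT}) :
  nilpotent G -> maximal M G -> M <| G.
Proof.
move=> nilG /maxgroupP[prM maxM]; have sMG := proper_sub prM.
have prMN := nilpotent_proper_norm nilG prM.
rewrite /normal sMG; apply/setIidPl/eqP; rewrite eqEproper subsetIl /=.
apply/negP => prNG; have := prMN.
by rewrite (maxM ('N_G(M))%G prNG (proper_sub prMN)) properxx.
Qed.

Lemma not_sub_Phi (gT : finGroupType) (G H : {group gT}) :
  H \subset G -> ~~ (H \subset 'Phi(G)) ->
  exists2 M : {group gT}, maximal M G & ~~ (H \subset M).
Proof.
move=> sHG not_sHPhi.
have [/existsP[M /andP[]] | noM] :=
    boolP [exists M : {group gT}, maximal M G && ~~ (H \subset M)].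
  by exists M.
(* The Frattini subgroup is defined as an intersection over the maximal
   subgroups together with [G] itself. *)
case/bigcapsP: not_sHPhi => M /orP[/eqP-> // | maxM].
by apply: contraNT noM => not_sHM; apply/existsP; exists M; rewrite maxM.
Qed.

Lemma Phi_nonfactor (gT : finGroupType) (G H K : {group gT}) :
  H \subset 'Phi(G) -> H * K = G -> K :=: G.
Proof.
move=> sHPhi defG; rewrite -[LHS]genGid; apply: Phi_nongen.
have sKG : K \subset G by rewrite -defG mulG_subr.
apply/eqP; rewrite eqEsubset join_subG Phi_sub sKG /= -{1}defG.
by rewrite mulG_subG joing_subr (subset_trans sHPhi) ?joing_subl.
Qed.

Theorem theorem2p1 (gT : finGroupType) (G : {group gT}) :
  (forall H : {group gT},
     comax_vertex G H -> [1 gT] \proper H -> H \subset 'Phi(G) ->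
     comax_isolated G H)
  /\
  (nilpotent G ->
   forall H : {group gT}, comax_isolated G H -> H \subset 'Phi(G)).
Proof.
split=> [H vH _ sHPhi | nilG H [vH isoH]].
  split=> // K; apply/negP => /and4P[_ /andP[_ prK] _ /eqP defG].
  by move: prK; rewrite (Phi_nonfactor sHPhi defG) properxx.
have /andP[ntH prH] := vH; have sHG := proper_sub prH.
apply/negPn/negP => /(not_sub_Phi sHG)[M maxM not_sHM].
have nMG := nilpotent_maximal_normal nilG maxM.
have /maxgroupP[prM topM] := maxM.
have ntM : M :!=: 1.
  apply: contraNneq ntH => M1.
  by rewrite -M1; apply/eqP; apply: topM; rewrite ?M1 ?sub1G.
case/negP: (isoH M); rewrite /comax_adj vH /comax_vertex ntM prM /=.
rewrite (normC (subset_trans sHG (normal_norm nMG))).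
rewrite (mulg_normal_maximal nMG maxM sHG not_sHM) eqxx andbT.
by apply: contraNneq not_sHM => ->.
Qed.
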